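(* Let $n\ge3$ and let $\epsilon\in\mathcal{E}_n$ be an Enriques diagram with multiplicity function $\underline{m}=(m_0,\dots,m_{n-1})$. Let $\epsilon'\in\mathcal{E}_n$ be a diagram obtained from $\epsilon$ by applying either a straightening operator $s_p$ or a breaking operator $b_p$, and let $\underline{m}'=(m_0',\dots,m_{n-1}')$ be its multiplicity function. Then: (1) $\underline{m}'>\underline{m}$, that is, $m_j'\ge m_j$ for all $j\in\{0,\dots,n-1\}$ and there is at least one strict inequality. (2) $m_0'\ge m_0$. The two multiplicities are equal if and only if $\epsilon'$ is obtained from $\epsilon$ by applying a breaking operator $b_p$ and moreover $e_{p-1}$ is a curved edge of $\epsilon$. (3) The Milnor number of $\epsilon'$ is strictly greater than the Milnor number of $\epsilon$.
   Context: A plane branch is a reduced irreducible germ $(C,O)$ of complex analytic curve on a germ $(\mathcal{S},O)$ of smooth complex analytic surface. A model over $(\mathcal{S},O)$ is a composition of finitely many blow-ups of points above $O$. An infinitely near point of $O$ is a point lying over $O$ on some model, two such points being identified when the bimeromorphic map between the models is an isomorphism near them. $E(P)$ denotes the exceptional curve created by blowing up $P$, and also its strict transforms. $Q$ is proximate to $P$ if $Q\in E(P)$. A point $\neq O$ is free if it is proximate to exactly one point, and satellite if it is proximate to two. The minimal embedded resolution of $(C,O)$ is obtained by repeatedly blowing up the unique point where the total transform of $C$ is not a normal crossing. Let $P_0=O,P_1,\dots,P_{n-1}$ be the points blown up, in order; $n$ is the blow-up complexity of $C$ ($n=0$ if $C$ is smooth, $n\ge3$ otherwise). Enriques diagram of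 $C$ (for $n\ge3$): the path graph with vertices $v_0,\dots,v_{n-1}$ (with $v_i$ corresponding to $P_i$) and edges $e_i=[v_{i-1}v_i]$, $1\le i\le n-1$, where each edge is decorated as curved or straight and each vertex as breaking or neutral, as follows. A straight path is a path of straight edges all of whose interior vertices are neutral; it is maximal if adding an adjacent edge never gives a straight path. (1) $e_i$ is curved iff $P_i$ is free. (2) If $P_{i+1},\dots,P_k$ are all the points of the sequence proximate to $P_i$ and $k\ge i+2$, then $[v_{i+1}v_k]$ is a maximal straight path, and if moreover $e_{i+1}$ is straight then $v_{i+1}$ is a breaking vertex. All other vertices are neutral. $\mathcal{E}_n$ is the set of isomorphism classes of Enriques diagrams of plane branches of blow-up complexity $n$. Always $e_1$ is curved, $e_{n-1}$ is straight and $v_0,v_1,v_{n-1}$ are neutral; a decoration with these properties is an Enriques diagram of complexity $n$ iff both edges adjacent to every breaking vertex are straight. Multiplicity function: $m_i$ is the multiplicity at $P_i$ of the strict transform of $C$ passing through $P_i$. It depends only on the diagram: $m_{n-1}=1$ and, for $i\le n-2$, $m_i=\sum_{k=i+1}^{j}m_k$ if there is a maximal straight path $[v_{i+1}v_j]$ with $j>i+1$, and $m_i=m_{i+1}$ otherwise. The Milnor number of a diagram is the Milnor number of a branch having that diagram; it equals $\mu=\sum_{i=0}^{n-1}m_i(m_i-1)$. Partially defined operators on $\mathcal{E}_n$ (decorations not mentioned are unchanged; the results are again in $\mathcal{E}_n$): - Straightening operator $s_p$ ($2\le p\le n-2$): defined on $\epsilon$ if $e_p$ is curved in $\epsilon$.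 $s_p(\epsilon)$ is obtained by declaring $e_p$ straight, aligned with $e_{p-1}$ if $e_{p-1}$ is straight in $\epsilon$ (i.e. $v_{p-1}$ stays neutral), and declaring $v_p$ breaking if $e_{p+1}$ is straight. - Breaking operator $b_p$ ($2\le p\le n-2$): defined on $\epsilon$ if $[v_{p-1}v_{p+1}]$ is a straight path of $\epsilon$ (i.e. $e_p,e_{p+1}$ are straight and $v_p$ is neutral). $b_p(\epsilon)$ is obtained by declaring $v_p$ breaking. *)

(* Defs.v *)
From mathcomp Require Import all_boot zify.

Set Implicit Arguments.
Unset Strict Implicit.
Unset Printing Implicit Defensive.

(* A decoration of the path graph v_0 - v_1 - ... - v_(n-1), where e_i joins
   v_(i-1) and v_i for 1 <= i <= n - 1.  [straight d i] says that e_i is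
   straight (otherwise it is curved), [breaking d i] that v_i is breaking
   (otherwise it is neutral). *)
Record decoration (n : nat) := Decoration {
  straight : nat -> bool;
  breaking : nat -> bool
}.

(* The set E_n, by its intrinsic description: a decoration is the Enriques
   diagram of a plane branch of blow-up complexity n >= 3 iff e_1 is curved,
   e_(n-1) is straight, v_0, v_1 and v_(n-1) are neutral and both edges
   adjacent to every breaking vertex are straight.  The first two conditions
   say that the decoration carries no information outside the path; they make
   equality of decorations coincide with isomorphism: as e_1 is curved and
   e_(n-1) straight, reversing the path never maps one Enriques diagram to
   another. *)
Definition enriques_diagram (n : nat) (d : decoration n) : Prop :=
  [/\ (forall i, straight d i -> 0 < i < n),
      (forall i, breaking d i -> i < n),
      ~~ straight d 1 /\ straight d n.-1,
      [/\ ~~ breaking d 0, ~~ breaking d 1 & ~~ breaking d n.-1] &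
      forall i, breaking d i -> straight d i /\ straight d i.+1].

(* [straight_path d i j]: [v_i v_j] is a straight path; [all] over the indices
   i + 1, ..., j of its edges and i + 1, ..., j - 1 of its interior vertices. *)
Definition straight_path (n : nat) (d : decoration n) (i j : nat) : bool :=
  [&& i < j, j < n,
      all (straight d) (iota i.+1 (j - i)) &
      all (fun k => ~~ breaking d k) (iota i.+1 (j - i.+1))].

Definition maximal_straight_path (n : nat) (d : decoration n) (i j : nat)
    : bool :=
  [&& straight_path d i j,
      (0 < i) ==> ~~ straight_path d i.-1 j &
      ~~ straight_path d i j.+1].

(* m_i, the multiplicity at P_i of the strict transform of any branch with
   diagram d, is computed from the diagram by downward recursion on i; see
   [multiplicity_function] below for the recursion itself.
   [mults_from d k] lists m_(n-1-k), ..., m_(n-1).  In the recursive step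
   i = n - k - 2, and [take (j - i)] selects m_(i+1), ..., m_j. *)
Fixpoint mults_from (n : nat) (d : decoration n) (k : nat) : seq nat :=
  if k is k'.+1 then
    let s := mults_from d k' in
    let i := n - k'.+2 in
    (if [seq j <- iota 0 n | maximal_straight_path d i.+1 j] is j :: _
     then sumn (take (j - i) s) else head 0 s) :: s
  else [:: 1].

Definition mult (n : nat) (d : decoration n) (i : nat) : nat :=
  nth 0 (mults_from d n.-1) i.

(* The Milnor number of any plane branch with diagram d, by the classical
   formula in terms of the multiplicities of its infinitely near points. *)
Definition milnor (n : nat) (d : decoration n) : nat :=
  \sum_(i < n) mult d i * (mult d i - 1).

(* The vertex v_(p-1), adjacent to the curved edge e_p, is neutral in an
   Enriques diagram and remains so: e_p is aligned with e_(p-1) if the latter is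
   straight. *)
Definition straightening (n p : nat) (d : decoration n)
    : option (decoration n) :=
  if [&& 2 <= p, p <= n - 2 & ~~ straight d p] then
    Some (Decoration n
            (fun i => (i == p) || straight d i)
            (fun i => ((i == p) && straight d p.+1) || breaking d i))
  else None.

Definition breaking_op (n p : nat) (d : decoration n)
    : option (decoration n) :=
  if [&& 2 <= p, p <= n - 2 & straight_path d p.-1 p.+1] then
    Some (Decoration n (straight d) (fun i => (i == p) || breaking d i))
  else None.

Lemma straight_pathP (n : nat) (d : decoration n) (i j : nat) :
  reflect [/\ i < j, j < n,
              forall k, i < k <= j -> straight d k &
              forall k, i < k < j -> ~~ breaking d k]
          (straight_path d i j).
Proof.
apply: (iffP and4P) => -[lt_ij lt_jn hs hb]; split=> //.
- by move=> k hk; apply: (allP hs); rewrite mem_iota; lia.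
- by move=> k hk; apply: (allP hb); rewrite mem_iota; lia.
- by apply/allP=> k; rewrite mem_iota => hk; apply: hs; lia.
- by apply/allP=> k; rewrite mem_iota => hk; apply: hb; lia.
Qed.

Lemma straight_path_prefix (n : nat) (d : decoration n) (i j k : nat) :
  i < j -> j <= k -> straight_path d i k -> straight_path d i j.
Proof.
move=> lt_ij le_jk /straight_pathP[_ lt_kn hs hb].
apply/straight_pathP; split=> [//||l hl|l hl]; first by lia.
- by apply: hs; lia.
- by apply: hb; lia.
Qed.

Lemma maximal_straight_path_inj (n : nat) (d : decoration n) (i j k : nat) :
  maximal_straight_path d i j -> maximal_straight_path d i k -> j = k.
Proof.
wlog lt_jk : j k / j < k => [hwlog hj hk|].
  case: (ltngtP j k) => // [lt_jk|lt_kj]; first exact: hwlog.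
  by apply/esym/hwlog.
move=> /and3P[hij _ /negP hmax] /and3P[hik _ _]; case: hmax.
by apply: straight_path_prefix hik => //; case/straight_pathP: hij; lia.
Qed.

Lemma size_mults_from (n : nat) (d : decoration n) (k : nat) :
  size (mults_from d k) = k.+1.
Proof. by elim: k => //= k ->. Qed.

Lemma nth_mults_from (n : nat) (d : decoration n) (k i : nat) :
  k < n -> i <= k -> nth 0 (mults_from d k) i = mult d (n.-1 - k + i).
Proof.
move=> lt_kn le_ik; rewrite /mult.
have [l ->] : exists l, n.-1 = l + k by exists (n.-1 - k); lia.
by rewrite addnK; elim: l.
Qed.

(* The proximity equalities, read on the diagram; [mult d] is their only
   solution on 0, ..., n - 1. *)
Definition multiplicity_function (n : nat) (d : decoration n)
    (m : nat -> nat) : Prop :=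
  [/\ m n.-1 = 1,
      (forall i j, i.+2 <= n -> i.+1 < j -> maximal_straight_path d i.+1 j ->
         m i = \sum_(i.+1 <= k < j.+1) m k) &
      (forall i, i.+2 <= n ->
         (forall j, i.+1 < j -> ~~ maximal_straight_path d i.+1 j) ->
         m i = m i.+1)].

Lemma sumn_take_nth (s : seq nat) (l : nat) :
  l <= size s -> sumn (take l s) = \sum_(0 <= k < l) nth 0 s k.
Proof.
elim: l s => [|l IHl] s hl; first by rewrite take0 big_geq.
by case: s hl => [//|x s] hl; rewrite big_nat_recl //= IHl.
Qed.

Lemma mult_multiplicity_function (n : nat) (d : decoration n) :
  0 < n -> multiplicity_function d (mult d).
Proof.
move=> n_gt0.
have step i : i.+2 <= n -> mult d i =
    if [seq j <- iota 0 n | maximal_straight_path d i.+1 j] is j :: _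
    then sumn (take (j - i) (mults_from d (n - i.+2))) else mult d i.+1.
  move=> hi; have := @nth_mults_from n d (n - i.+2).+1 0.
  rewrite /= (_ : n - (n - i.+2).+2 = i); last lia.
  rewrite (_ : n.-1 - (n - i.+2).+1 + 0 = i); last lia.
  move=> <- //; last lia.
  have := @nth_mults_from n d (n - i.+2) 0.
  rewrite nth0 (_ : n.-1 - (n - i.+2) + 0 = i.+1); last lia.
  by move=> -> //; lia.
split=> [|i j hi lt_ij hmax|i hi hno].
- by have := @nth_mults_from n d 0 0; rewrite subn0 addn0 /= => <-.
- have lt_jn : j < n by case/and3P: hmax => /straight_pathP[].
  rewrite step //.
  case E : [seq _ <- _ | _] => [|k s].
    have : j \in [seq k <- iota 0 n | maximal_straight_path d i.+1 k].
      by rewrite mem_filter hmax mem_iota.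
    by rewrite E.
  have : k \in [seq k <- iota 0 n | maximal_straight_path d i.+1 k].
    by rewrite E mem_head.
  rewrite mem_filter => /andP[hk _].
  rewrite -(maximal_straight_path_inj hmax hk) sumn_take_nth; last first.
    by rewrite size_mults_from; lia.
  rewrite -{2}[i.+1]add0n big_addn (_ : j.+1 - i.+1 = j - i); last lia.
  apply: eq_big_nat => l hl; rewrite nth_mults_from; try lia.
  by congr (mult d _); lia.
- rewrite step //; case E : [seq _ <- _ | _] => [//|k s].
  have : k \in [seq k <- iota 0 n | maximal_straight_path d i.+1 k].
    by rewrite E mem_head.
  rewrite mem_filter => /andP[hk _]; move: (hno k).
  by rewrite hk => /(_ _)/negP; case=> //; case/and3P: hk => /straight_pathP[].
Qed.

Lemma multiplicity_function_unique (n : nat) (d : decoration n)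
    (m : nat -> nat) :
  0 < n -> multiplicity_function d m -> forall i, i < n -> m i = mult d i.
Proof.
move=> n_gt0 [m1 m2 m3].
have [M1 M2 M3] := mult_multiplicity_function d n_gt0.
suff h k i : n <= i + k -> i < n -> m i = mult d i.
  by move=> i lt_in; apply: (h n) => //; lia.
elim: k i => [|k IHk] i hk lt_in; first lia.
have [->|ne_in] := eqVneq i n.-1; first by rewrite m1 M1.
have hi : i.+2 <= n by lia.
have [/hasP[j _ hj]|/hasPn hno] :=
    boolP (has (maximal_straight_path d i.+1) (iota 0 n)).
  have /straight_pathP[lt_ij lt_jn _ _] : straight_path d i.+1 j.
    by case/and3P: hj.
  rewrite (m2 i j) // (M2 i j) //; apply: eq_big_nat => l hl.
  by apply: IHk; lia.
have {}hno j : i.+1 < j -> ~~ maximal_straight_path d i.+1 j.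
  move=> _; have [lt_jn|le_nj] := ltnP j n; first by rewrite hno ?mem_iota.
  apply/negP=> /and3P[/straight_pathP[_ lt_jn _ _] _ _]; lia.
by rewrite m3 // M3 //; apply: IHk; lia.
Qed.

Lemma straightening_enriques (n p : nat) (d d' : decoration n) :
  enriques_diagram d -> straightening p d = Some d' -> enriques_diagram d'.
Proof.
move=> [hs hb [h1 h2] [b0 b1 bn] hbs]; rewrite /straightening.
case: ifP => // /and3P[p2 pn hp] [<-]; split=> /=.
- by move=> i /orP[/eqP->|/hs //]; lia.
- by move=> i /orP[/andP[/eqP-> _]|/hb //]; lia.
- by rewrite h2 orbT; split=> //; rewrite negb_or h1 andbT; lia.
- rewrite !negb_or b0 b1 bn !andbT !negb_and.
  by split; apply/orP; left; lia.
- move=> i /orP[/andP[/eqP-> hp1]|/hbs[-> ->]]; last by rewrite !orbT.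
  by rewrite eqxx hp1 orbT.
Qed.

Lemma breaking_op_enriques (n p : nat) (d d' : decoration n) :
  enriques_diagram d -> breaking_op p d = Some d' -> enriques_diagram d'.
Proof.
move=> [hs hb [h1 h2] [b0 b1 bn] hbs]; rewrite /breaking_op.
case: ifP => // /and3P[p2 pn /straight_pathP[_ _ hp _]] [<-]; split=> //=.
- by move=> i /orP[/eqP->|/hb //]; lia.
- by rewrite !negb_or b0 b1 bn !andbT; split; lia.
- by move=> i /orP[/eqP->|/hbs //]; split; apply: hp; lia.
Qed.

(* Main.v *)
Require Import Defs.
From mathcomp Require Import all_boot zify.

(* An operator changes the maximal straight paths only locally.  Straightening
   e_p lengthens by one vertex the path (possibly reduced to a vertex) ending at
   v_(p-1), so one proximity equality gains the positive summand m_p.  Breaking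
   at p cuts a path [v_a v_b] into [v_a v_p] and [v_p v_b].  The multiplicities
   at a, ..., b - 1 all equal M = m_p; those at a, ..., p - 1 become
   (b - p) M + m_b > M, and
     m'_(a-1) - m_(a-1) = (p - a - 1) ((b - p - 1) M + m_b),
   which vanishes iff a = p - 1.  Everything propagates down to index 0 through
   the proximity equalities; if a = p - 1 the increase at v_a reaches index 0
   unless no straight path ends at v_a, that is, unless e_(p-1) is curved. *)

Set Implicit Arguments.
Unset Strict Implicit.
Unset Printing Implicit Defensive.

(** * Straight runs, proximity ranges and multiplicities in one diagram *)

(** A curved e_i and a breaking v_i equally prevent a straight path from continuing to the left of
    v_i. *)
Definition run_start (n : nat) (d : decoration n) (i : nat) : bool :=
  ~~ straight d i || breaking d i.

(* P_(i+1), ..., P_j are all the points proximate to P_i; the degenerate case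
   j = i + 1, where no maximal straight path starts at v_(i+1), is included. *)
Definition proximity_range (n : nat) (d : decoration n) (i j : nat) : Prop :=
  [/\ i < j < n,
      i.+1 < j -> run_start d i.+1,
      forall k, i.+1 < k <= j -> straight d k,
      forall k, i.+1 < k < j -> ~~ breaking d k &
      run_start d i.+1 -> ~~ straight d j.+1 || (i.+1 < j) && breaking d j].

(* [lia] splits on every boolean of the context; for purely numerical goals the
   facts on decorations are dropped first. *)
Ltac order_lia :=
  repeat match goal with
  | H : context [@straight] |- _ => clear H
  | H : context [@breaking] |- _ => clear H
  | H : context [@run_start] |- _ => clear H
  | H : context [@proximity_range] |- _ => clear H
  end; lia.

Section OneDiagram.

Variables (n : nat) (d : decoration n).
Hypothesis d_enriques : enriques_diagram d.

(** Take the furthest vertex reachable from v_a through straight edges and neutral interior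
    vertices; no edge beyond e_(n-1) is straight. *)
Lemma straight_run_end (a : nat) :
  a < n -> exists2 b, a <= b < n &
    [/\ forall k, a < k <= b -> straight d k,
        forall k, a < k < b -> ~~ breaking d k &
        ~~ straight d b.+1 || (a < b) && breaking d b].
Proof.
move=> lt_an; have [straight_lt _ _ _ _] := d_enriques.
pose P b := (a <= b) && all (fun k => straight d k) (iota a.+1 (b - a))
  && all (fun k => ~~ breaking d k) (iota a.+1 (b - a.+1)) && (b < n).
have exP : exists b, P b.
  exists a; rewrite /P leqnn lt_an subnn (_ : a - a.+1 = 0) //; lia.
have boundP b : P b -> b <= n by case/andP; lia.
case: (ex_maxnP exP boundP) => b /andP[/andP[/andP[le_ab sb] bb] lt_bn] maxb.
have sb' k : a < k <= b -> straight d k.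
  by move=> hk; apply: (allP sb); rewrite mem_iota; lia.
have bb' k : a < k < b -> ~~ breaking d k.
  by move=> hk; apply: (allP bb); rewrite mem_iota; lia.
exists b; first by rewrite le_ab.
split=> //; rewrite -implybE; apply/implyP => sb1; apply/negP => nbb.
(* Otherwise the run could be prolonged along e_(b+1), against the maximality of [b]. *)
suff /maxb : P b.+1 by rewrite ltnn.
have lt_b1n : b.+1 < n by case/andP: (straight_lt _ sb1).
rewrite /P lt_b1n (leqW le_ab) !andbT; apply/andP; split; apply/allP => k.
  rewrite mem_iota => hk; case: (ltngtP k b.+1) => [lt_kb||->] //; last lia.
  by apply: sb'; lia.
rewrite mem_iota => hk; case: (ltngtP k b) => [lt_kb|lt_bk|eq_kb]; last 2 first.
- lia.
- apply/negP => bk; apply: nbb; rewrite -eq_kb bk andbT; lia.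
by apply: bb'; lia.
Qed.

Lemma proximity_range_exists (i : nat) :
  i.+1 < n -> exists j, proximity_range d i j.
Proof.
move=> lt_in; have [st|nst] := boolP (run_start d i.+1).
  have [j hj [h1 h2 h3]] := straight_run_end lt_in.
  by exists j; split=> //; lia.
by exists i.+1; split=> //; lia.
Qed.

(** At the shorter end v_j the next edge is straight, so v_j must be breaking, although it is
    interior to the longer range. *)
Lemma proximity_range_inj (i j k : nat) :
  proximity_range d i j -> proximity_range d i k -> j = k.
Proof.
wlog lt_jk : j k / j < k => [hwlog hj hk|].
  case: (ltngtP j k) => // [lt_jk|lt_kj]; first exact: hwlog.
  by apply/esym/hwlog.
move=> [hij _ _ _ stop] [hik st sk bk _].
have := stop (st ltac:(lia)); rewrite sk /=; last lia.
by case/andP=> lt_ij; rewrite (negbTE (bk _ _)) //; lia.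
Qed.

(** Walking back from v_k through straight edges and neutral vertices stops at v_1 at the latest,
    since e_1 is curved. *)
Lemma run_start_exists (k : nat) :
  0 < k -> exists2 a, 0 < a <= k & run_start d a /\
    forall j, a < j <= k -> straight d j /\ ~~ breaking d j.
Proof.
have [_ _ [curved1 _] _ _] := d_enriques.
elim: k => // k IHk _; have [st|] := boolP (run_start d k.+1).
  by exists k.+1; [rewrite leqnn|split=> // j hj; lia].
rewrite negb_or negbK => /andP[sk nbk].
have k_gt0 : 0 < k by case: k sk {nbk IHk} => // s1; rewrite s1 in curved1.
have [a ha [sa h]] := IHk k_gt0; exists a; first lia.
split=> // j hj; case: (ltngtP j k.+1) => [lt_jk||->] //; last lia.
by apply: h; lia.
Qed.

(** Merges both cases of the multiplicity recursion into one sum, which all later comparisons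
    use. *)
Lemma mult_proximity_range (i j : nat) :
  proximity_range d i j -> mult d i = \sum_(i.+1 <= k < j.+1) mult d k.
Proof.
have [straight_lt _ _ _ _] := d_enriques.
move=> [/andP[lt_ij lt_jn] st sk bk stop].
have n_gt0 : 0 < n by lia.
have [_ m2 m3] := mult_multiplicity_function d n_gt0.
have [lt_i1j|le_ji1] := ltnP i.+1 j.
  have {}st := st lt_i1j; apply: m2 => //; first lia.
  apply/and3P; split.
  - by apply/straight_pathP; split.
  - rewrite /=; apply/negP => /straight_pathP[_ _ s b].
    case/orP: st => [/negP|bi]; first by apply; apply: s; lia.
    by have /negP := b i.+1 ltac:(lia).
  - apply/negP => /straight_pathP[_ _ s b].
    case/orP: (stop st) => [/negP|/andP[_ bj]]; first by apply; apply: s; lia.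
    by have /negP := b j ltac:(lia).
(* Degenerate range: either e_(i+2) is curved, or e_(i+1) prolongs to the left every straight path
   from v_(i+1); so none is maximal. *)
have eq_ji : j = i.+1 by lia.
rewrite eq_ji in lt_jn stop *; rewrite big_nat1; apply: m3 => // l lt_il.
apply/negP => /and3P[/straight_pathP[_ lt_ln s b] /= notl _].
case/negP: notl; have [st1|] := boolP (run_start d i.+1).
  move: (stop st1); rewrite ltnn orbF => /negP[]; apply: s; lia.
rewrite negb_or negbK => /andP[si nbi]; apply/straight_pathP.
split=> // [|k hk|k hk]; first lia.
- case: (ltngtP k i.+1) => [||->] // ?; first lia.
  by apply: s; lia.
- case: (ltngtP k i.+1) => [||->] // ?; first lia.
  by apply: b; lia.
Qed.

Lemma mult_gt0 (i : nat) : i < n -> 0 < mult d i.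
Proof.
move: {2}(n - i) (leqnn (n - i)) => k; elim: k i => [|k IHk] i hk lt_in.
  lia.
have [lt_i1n|le_ni1] := ltnP i.+1 n.
  have [j hj] := proximity_range_exists lt_i1n.
  have [/andP[lt_ij lt_jn] _ _ _ _] := hj.
  rewrite (mult_proximity_range hj) big_ltn //.
  by rewrite addn_gt0 IHk //; lia.
have n_gt0 : 0 < n by lia.
have [m1 _ _] := mult_multiplicity_function d n_gt0.
by rewrite (_ : i = n.-1) ?m1; lia.
Qed.

(** P_(i+1) is then the only point proximate to P_i. *)
Lemma mult_not_start (i : nat) :
  i.+1 < n -> ~~ run_start d i.+1 -> mult d i = mult d i.+1.
Proof.
move=> lt_in nst; rewrite (@mult_proximity_range i i.+1) ?big_nat1 //.
by split=> //; try lia; rewrite (negbTE nst).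
Qed.

Lemma mult_run_const (a b : nat) :
  b < n -> (forall k, a < k <= b -> ~~ run_start d k) ->
  forall i, a <= i <= b -> mult d i = mult d b.
Proof.
move=> lt_bn nst i; move: {2}(b - i) (leqnn (b - i)) => k.
elim: k i => [|k IHk] i hk hi; first by congr mult; lia.
have [->//|ne_ib] := eqVneq i b.
by rewrite mult_not_start; [apply: IHk; lia|lia|apply: nst; lia].
Qed.

End OneDiagram.

(** * Comparison of sums over nested intervals *)

Lemma leq_sum_nat_widen (f g : nat -> nat) (a b c : nat) :
  b <= c -> (forall k, a <= k < b -> f k <= g k) ->
  \sum_(a <= k < b) f k <= \sum_(a <= k < c) g k.
Proof.
move=> le_bc le_fg; apply: (@leq_trans (\sum_(a <= k < b) g k)).
  rewrite big_nat_cond [leqRHS]big_nat_cond.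
  by apply: leq_sum => k /andP[/le_fg].
have [le_ab|lt_ba] := leqP a b; last by rewrite big_geq // ltnW.
by rewrite (big_cat_nat le_ab le_bc) leq_addr.
Qed.

Lemma ltn_sum_nat_widen (f g : nat -> nat) (a b c r : nat) :
  b <= c -> (forall k, a <= k < b -> f k <= g k) ->
  a <= r < b -> f r < g r ->
  \sum_(a <= k < b) f k < \sum_(a <= k < c) g k.
Proof.
move=> le_bc le_fg /andP[le_ar lt_rb] lt_fg.
rewrite (big_cat_nat le_ar (ltnW lt_rb)) /= [\sum_(r <= k < b) _]big_ltn //.
rewrite (big_cat_nat le_ar (ltnW (leq_trans lt_rb le_bc))) /=.
rewrite [\sum_(r <= k < c) _]big_ltn; last exact: leq_trans le_bc.
rewrite -addnS -addSn; apply: leq_add.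
  by apply: leq_sum_nat_widen => // k hk; apply: le_fg; lia.
apply: leq_add => //; apply: leq_sum_nat_widen => // k hk.
by apply: le_fg; lia.
Qed.

Lemma sum_nat_eq_const (f : nat -> nat) (a b c : nat) :
  (forall k, a <= k < b -> f k = c) -> \sum_(a <= k < b) f k = (b - a) * c.
Proof.
by move=> eq_fc; rewrite (eq_big_nat _ _ eq_fc) sum_nat_const_nat.
Qed.

(** * Propagation of comparisons between two diagrams *)

(** The bound [k] serves the breaking operator, which shortens the range of one index; growth is
    required only below that index. *)
Definition ranges_grow_below (n : nat) (d d' : decoration n) (k : nat) : Prop :=
  forall i j, i < k -> proximity_range d i j ->
    exists2 j', j <= j' & proximity_range d' i j'.

Section TwoDiagrams.

Variables (n : nat) (d d' : decoration n).
Hypothesis d_enriques : enriques_diagram d.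
Hypothesis d'_enriques : enriques_diagram d'.

(** Downward induction: below [k] both the range of summation and its terms can only increase. *)
Lemma mult_leq_below (k : nat) :
  k < n -> ranges_grow_below d d' k ->
  (forall i, k <= i < n -> mult d i <= mult d' i) ->
  forall i, i < n -> mult d i <= mult d' i.
Proof.
move=> lt_kn grow le_above i.
move: {2}(n - i) (leqnn (n - i)) => l; elim: l i => [|l IHl] i hl lt_in.
  lia.
have [le_ki|lt_ik] := leqP k i; first by apply: le_above; rewrite le_ki.
have [j hj] := proximity_range_exists d_enriques (leq_ltn_trans lt_ik lt_kn).
have [j' le_jj' hj'] := grow _ _ lt_ik hj.
have [/andP[lt_ij lt_jn] _ _ _ _] := hj.
rewrite (mult_proximity_range d_enriques hj).
rewrite (mult_proximity_range d'_enriques hj').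
by apply: leq_sum_nat_widen => // r hr; apply: IHl; lia.
Qed.

(** P_(k+1) is always proximate to P_k, so a strict increase descends one index at a time. *)
Lemma mult_ltn_below (k : nat) :
  k < n -> ranges_grow_below d d' k ->
  (forall i, i < n -> mult d i <= mult d' i) ->
  mult d k < mult d' k -> mult d 0 < mult d' 0.
Proof.
elim: k => // k IHk lt_kn grow le_m lt_m.
apply: IHk => //; first by lia.
  by move=> i j lt_ik; apply: grow; apply: ltnW.
have [j hj] := proximity_range_exists d_enriques lt_kn.
have [j' le_jj' hj'] := grow _ _ (ltnSn k) hj.
have [/andP[lt_ij lt_jn] _ _ _ _] := hj.
rewrite (mult_proximity_range d_enriques hj).
rewrite (mult_proximity_range d'_enriques hj').
apply: (@ltn_sum_nat_widen _ _ _ _ _ k.+1) => //; last lia.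
by move=> r hr; apply: le_m; lia.
Qed.

Lemma mult_eq_above (k : nat) :
  (forall i j, k <= i -> proximity_range d i j -> proximity_range d' i j) ->
  forall i, k <= i < n -> mult d i = mult d' i.
Proof.
move=> same i; move: {2}(n - i) (leqnn (n - i)) => l.
elim: l i => [|l IHl] i hl hi; first lia.
have [lt_i1n|le_ni1] := ltnP i.+1 n; last first.
  have n_gt0 : 0 < n by lia.
  have [m1 _ _] := mult_multiplicity_function d n_gt0.
  have [m1' _ _] := mult_multiplicity_function d' n_gt0.
  by rewrite (_ : i = n.-1) ?m1 ?m1'; lia.
have [j hj] := proximity_range_exists d_enriques lt_i1n.
have hj' : proximity_range d' i j by apply: same => //; lia.
have [/andP[lt_ij lt_jn] _ _ _ _] := hj.
rewrite (mult_proximity_range d_enriques hj).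
rewrite (mult_proximity_range d'_enriques hj').
by apply: eq_big_nat => r hr; apply: IHl; lia.
Qed.

(** Ranges of indices below [k] stop at [k], so m_k alone determines all earlier multiplicities. *)
Lemma mult_eq_below (k : nat) :
  k < n ->
  (forall i j, i < k -> proximity_range d i j ->
     j <= k /\ proximity_range d' i j) ->
  mult d k = mult d' k -> forall i, i <= k -> mult d i = mult d' i.
Proof.
move=> lt_kn same eq_k i; move: {2}(k - i) (leqnn (k - i)) => l.
elim: l i => [|l IHl] i hl le_ik; first by rewrite (_ : i = k) //; lia.
have [->//|ne_ik] := eqVneq i k; have lt_ik : i < k by lia.
have [j hj] := proximity_range_exists d_enriques (leq_ltn_trans lt_ik lt_kn).
have [le_jk hj'] := same _ _ lt_ik hj.
rewrite (mult_proximity_range d_enriques hj).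
rewrite (mult_proximity_range d'_enriques hj').
by apply: eq_big_nat => r hr; apply: IHl; lia.
Qed.

(** The function x (x - 1) is strictly increasing for x >= 1, and multiplicities are positive. *)
Lemma milnor_ltn :
  (forall i, i < n -> mult d i <= mult d' i) ->
  (exists2 i, i < n & mult d i < mult d' i) -> milnor d < milnor d'.
Proof.
move=> le_m [i lt_in lt_m]; rewrite /milnor.
rewrite (bigD1 (Ordinal lt_in)) //= [ltnRHS](bigD1 (Ordinal lt_in)) //=.
rewrite -addSn leq_add //.
  by have := mult_gt0 d_enriques lt_in; nia.
by apply: leq_sum => k _; rewrite leq_mul ?leq_sub2r ?le_m.
Qed.

End TwoDiagrams.

(** * Effect of the operators on proximity ranges *)

(** The index i + 1 is where the run ending at v_(p-1) starts; the point P_i gains P_p as a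
    proximate point. *)
Lemma straightening_ranges (n p : nat) (d d' : decoration n) :
  enriques_diagram d -> straightening p d = Some d' ->
  exists2 i, i.+1 < p < n &
    [/\ proximity_range d i p.-1, proximity_range d' i p &
        forall k j, k != i -> proximity_range d k j -> proximity_range d' k j].
Proof.
move=> d_enriques; have [_ _ _ _ adj] := d_enriques.
rewrite /straightening; case: ifP => // /and3P[p2 pn curved_p] [<-].
have [a ha [sa ra]] := run_start_exists d_enriques (k := p.-1) ltac:(order_lia).
exists a.-1; first by order_lia.
rewrite /proximity_range /run_start /= (_ : a.-1.+1 = a); last by order_lia.
rewrite (_ : p.-1.+1 = p); last by order_lia.
have ne_ap : (a == p) = false by order_lia.
rewrite /run_start in sa; split.
- split=> //; first by order_lia.
  + by move=> k hk; have [] := ra k ltac:(order_lia).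
  + by move=> k hk; have [] := ra k ltac:(order_lia).
  + by rewrite curved_p.
- rewrite ne_ap /= eqxx; split=> //; first by order_lia.
  + move=> k hk; have [//|ne_kp] := eqVneq k p.
    by have [-> _] := ra k ltac:(order_lia).
  + move=> k hk; have -> /= : (k == p) = false by order_lia.
    by have [] := ra k ltac:(order_lia).
  + move=> _; have -> /= : (p.+1 == p) = false by order_lia.
    have -> /= : a < p by order_lia.
    by case: (straight d p.+1).
- move=> k j ne_ki [hkj st sk bk stop]; split=> //.
  (* If k + 1 = p, the range is nontrivial, so e_(p+1) is straight and v_p becomes breaking. *)
  + move=> lt_kj; have := st lt_kj; have := sk k.+2 ltac:(order_lia).
    by have [-> /= ->|] := eqVneq k.+1 p.
  + by move=> l hl; rewrite sk ?orbT.
  + move=> l hl; rewrite negb_or bk // andbT negb_and.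
    have := sk l ltac:(order_lia); have [->|//] := eqVneq l p.
    by rewrite (negbTE curved_p).
  + move=> st'; have {}st : ~~ straight d k.+1 || breaking d k.+1.
      by move: st'; have [->|//] := eqVneq k.+1 p; rewrite curved_p.
    have := stop st; have [eq_jp _|_] := eqVneq j.+1 p; last first.
      by case/orP=> [->//|/andP[-> ->]]; rewrite !orbT.
    (* No other range that stops with [run_start] ends at v_(p-1): a start strictly after v_a would
       be inside the run, and a start before it makes v_a = v_(p-1) breaking next to the curved
       e_p. *)
    have [lt_ka|le_ak] := ltnP k.+1 a; last first.
      have [str nbr] := ra k.+1 ltac:(order_lia).
      by rewrite str (negbTE nbr) in st.
    have str_a := sk a ltac:(order_lia); move: sa; rewrite str_a /= => br_a.
    have eq_aj : a = j.
      have [//|ne_aj] := eqVneq a j.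
      by have := bk a ltac:(order_lia); rewrite br_a.
    by have [_] := adj a br_a; rewrite eq_aj eq_jp (negbTE curved_p).
Qed.

(** With a = i + 1, the path [v_a v_j] is cut at v_p: P_i loses P_(p+1), ..., P_j, which become
    proximate to P_(p-1). *)
Lemma breaking_op_ranges (n p : nat) (d d' : decoration n) :
  enriques_diagram d -> breaking_op p d = Some d' ->
  exists i, exists2 j, i.+1 < p < j /\ j < n &
    [/\ proximity_range d i j, proximity_range d' i p,
        proximity_range d' p.-1 j,
        (forall k l, k != i -> k != p.-1 ->
           proximity_range d k l -> proximity_range d' k l) &
        (forall k, i.+1 < k < j -> ~~ run_start d k) /\
        (forall k, i.+1 < k < p -> ~~ run_start d' k)].
Proof.
move=> d_enriques; rewrite /breaking_op.
case: ifP => // /and3P[p2 pn /straight_pathP[_ _ sp bp]] [<-].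
have {}bp := bp p ltac:(order_lia).
have sp1 := sp p.+1 ltac:(order_lia); have {}sp := sp p ltac:(order_lia).
have [a ha [sa ra]] := run_start_exists d_enriques (k := p.-1) ltac:(order_lia).
have {}ra k : a < k <= p -> straight d k /\ ~~ breaking d k.
  by move=> hk; have [->//|ne_kp] := eqVneq k p; apply: ra; order_lia.
have [j hj] := proximity_range_exists d_enriques (i := a.-1) ltac:(order_lia).
have [lt_ij st sk bk stop] := hj.
rewrite (_ : a.-1.+1 = a) in st sk bk stop; last by order_lia.
have {}stop := stop sa.
(* The run from v_a crosses the neutral vertex v_p, both of whose edges are straight. *)
have lt_pj : p < j.
  rewrite ltnNge; apply/negP => le_jp.
  have str_j : straight d j.+1.
    have [->//|ne_jp] := eqVneq j p.
    by have [] := ra j.+1 ltac:(order_lia).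
  move: stop; rewrite str_j => /andP[lt_aj].
  by have [_ /negbTE->] := ra j ltac:(order_lia).
have ne_ap : (a == p) = false by order_lia.
have ne_jp : (j == p) = false by order_lia.
exists a.-1, j; first by order_lia.
rewrite /proximity_range /run_start /= in sa hj *.
rewrite (_ : a.-1.+1 = a) in hj *; last by order_lia.
rewrite (_ : p.-1.+1 = p); last by order_lia.
rewrite ne_ap eqxx ne_jp /= orbT; split=> //.
- split=> //; first by order_lia.
  + by move=> k hk; have [] := ra k ltac:(order_lia).
  + move=> k hk; have -> /= : (k == p) = false by order_lia.
    by have [] := ra k ltac:(order_lia).
  + by move=> _; rewrite (_ : a < p) ?orbT //; order_lia.
- split=> //; first by order_lia.
  + by move=> k hk; apply: sk; order_lia.
  + move=> k hk; have -> /= : (k == p) = false by order_lia.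
    by apply: bk; order_lia.
  + move=> _; rewrite lt_pj /=.
    by case/orP: stop => [->//|/andP[_ ->]]; rewrite orbT.
- move=> k l ne_ki ne_kp [hkl stk skl bkl stopk].
  have -> : (k.+1 == p) = false by order_lia.
  split=> //.
  (* Another range with v_p in its interior would have to cross v_a or start strictly inside the
     run; both are impossible. *)
  + move=> m hm; rewrite negb_or bkl // andbT; apply/eqP => eq_mp.
    have [lt_ka|le_ak] := ltnP k.+1 a.
      by move: sa; rewrite skl ?(negbTE (bkl _ _)) //; order_lia.
    have [str nbr] := ra k.+1 ltac:(order_lia).
    by move: (stk ltac:(order_lia)); rewrite str (negbTE nbr).
  + move=> stk1; have := stopk stk1.
    by case/orP=> [->//|/andP[-> ->]]; rewrite !orbT.
- split=> k hk; first by rewrite sk ?(negbTE (bk _ _)) //; order_lia.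
  have [-> nbr] := ra k ltac:(order_lia).
  by rewrite /= negb_or nbr andbT; order_lia.
Qed.

(** * Multiplicities under the two operators *)

Lemma mult_straightening (n p : nat) (d d' : decoration n) :
  enriques_diagram d -> enriques_diagram d' -> straightening p d = Some d' ->
  (forall i, i < n -> mult d i <= mult d' i) /\ mult d 0 < mult d' 0.
Proof.
move=> d_enriques d'_enriques op.
have [i lt_ip [hi hi' same]] := straightening_ranges d_enriques op.
have grow k l : proximity_range d k l ->
    exists2 l', l <= l' & proximity_range d' k l'.
  move=> hkl; have [eq_ki|ne_ki] := eqVneq k i; last by exists l; auto.
  rewrite eq_ki in hkl *; exists p => //.
  by rewrite (proximity_range_inj hkl hi) leq_pred.
have lt_n1n : n.-1 < n by lia.
have le_m k : k < n -> mult d k <= mult d' k.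
  apply: (mult_leq_below d_enriques d'_enriques lt_n1n) => // [l j _|l hl].
    exact: grow.
  have n_gt0 : 0 < n by lia.
  have [m1 _ _] := mult_multiplicity_function d n_gt0.
  have [m1' _ _] := mult_multiplicity_function d' n_gt0.
  by rewrite (_ : l = n.-1) ?m1 ?m1'; lia.
split=> //; apply: (mult_ltn_below d_enriques d'_enriques (k := i)) => //.
- lia.
- by move=> l j _; apply: grow.
rewrite (mult_proximity_range d_enriques hi).
rewrite (mult_proximity_range d'_enriques hi').
rewrite (_ : p.-1.+1 = p); last lia.
(* Isolate the new summand [mult d' p], which is positive. *)
rewrite [ltnRHS]big_nat_recr /=; last lia.
rewrite -addn1; apply: leq_add; last by apply: mult_gt0 => //; lia.
by apply: leq_sum_nat_widen => // k hk; apply: le_m; lia.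
Qed.

Lemma mult_breaking_op (n p : nat) (d d' : decoration n) :
  enriques_diagram d -> enriques_diagram d' -> breaking_op p d = Some d' ->
  [/\ forall i, i < n -> mult d i <= mult d' i,
      exists2 i, i < n & mult d i < mult d' i &
      (mult d' 0 == mult d 0) = ~~ straight d p.-1].
Proof.
move=> d_enriques d'_enriques op.
have [i [j [lt_ip lt_jn]]] := breaking_op_ranges d_enriques op.
move=> [hi hi' hp same [nst_d nst_d']].
have eq_above : forall k, p <= k < n -> mult d k = mult d' k.
  by apply: mult_eq_above => // l r le_pl; apply: same; order_lia.
(* No vertex strictly between v_(i+1) and v_j starts a run; the value at [j] itself may differ. *)
have const_d k : i < k < j -> mult d k = mult d p.
  have lt_j1n : j.-1 < n by lia.
  have nst l : i.+1 < l <= j.-1 -> ~~ run_start d l.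
    by move=> hl; apply: nst_d; order_lia.
  move=> hk.
  rewrite (mult_run_const d_enriques lt_j1n nst (i := k)); last by order_lia.
  by rewrite (mult_run_const d_enriques lt_j1n nst (i := p)) //; order_lia.
have const_d' k : i < k < p -> mult d' k = mult d' p.-1.
  move=> hk; apply: (mult_run_const d'_enriques (a := i.+1)); try order_lia.
  by move=> l hl; apply: nst_d'; order_lia.
have mult_p1' : mult d' p.-1 = (j - p) * mult d p + mult d j.
  rewrite (mult_proximity_range d'_enriques hp) big_nat_recr /=; last lia.
  rewrite (_ : p.-1.+1 = p) -?eq_above; try lia.
  congr (_ + _); apply: sum_nat_eq_const => k hk.
  by rewrite -eq_above ?const_d; lia.
have mult_i : mult d i = (j - i.+1) * mult d p + mult d j.
  rewrite (mult_proximity_range d_enriques hi) big_nat_recr /=; last lia.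
  congr (_ + _); apply: sum_nat_eq_const => k hk.
  by apply: const_d; lia.
have mult_i' : mult d' i = (p - i.+1) * mult d' p.-1 + mult d p.
  rewrite (mult_proximity_range d'_enriques hi') big_nat_recr /=; last lia.
  rewrite -eq_above; last lia.
  by congr (_ + _); apply: sum_nat_eq_const => k hk; apply: const_d'; lia.
have mult_diff : mult d' i =
    mult d i + (p - i.+2) * ((j - p.+1) * mult d p + mult d j).
  rewrite mult_i' mult_i mult_p1'.
  (* The offsets [x] and [y] remove the truncated subtractions, leaving a polynomial identity. *)
  have [x eq_p] : exists x, p = i.+2 + x by exists (p - i.+2); lia.
  have [y eq_j] : exists y, j = p.+1 + y by exists (j - p.+1); lia.
  rewrite (_ : p - i.+1 = x.+1); last lia.
  rewrite (_ : p - i.+2 = x); last lia.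
  rewrite (_ : j - p = y.+1); last lia.
  rewrite (_ : j - p.+1 = y); last lia.
  rewrite (_ : j - i.+1 = x + y + 2); last lia.
  nia.
have mult_j_gt0 : 0 < mult d j by apply: (mult_gt0 d_enriques).
have mult_p1 : mult d p.-1 = mult d p by apply: const_d; order_lia.
have mult_p_lt : mult d p < mult d' p.-1.
  by rewrite mult_p1' -addn1 leq_add // leq_pmull //; order_lia.
have lt_in : i < n by lia.
have grow k l : k < i -> proximity_range d k l ->
    exists2 l', l <= l' & proximity_range d' k l'.
  by move=> lt_ki hkl; exists l => //; apply: same => //; lia.
have le_m : forall k, k < n -> mult d k <= mult d' k.
  apply: (mult_leq_below d_enriques d'_enriques (k := i)) => // k hk.
  have [lt_kp|le_pk] := ltnP k p; last by rewrite eq_above //; lia.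
  have [->|ne_ki] := eqVneq k i; first by rewrite mult_diff leq_addr.
  rewrite const_d ?const_d'; [exact: ltnW | order_lia..].
split=> //; first by exists p.-1; [lia|rewrite mult_p1].
have [_ _ [curved1 _] _ _] := d_enriques.
have [str|curved] /= := boolP (straight d p.-1).
- suff lt_m0 : mult d 0 < mult d' 0 by rewrite gtn_eqF.
  have [lt_i2p|le_pi2] := ltnP i.+2 p.
    apply: (mult_ltn_below d_enriques d'_enriques (k := i)) => //.
    rewrite mult_diff -[ltnLHS]addn0 ltn_add2l muln_gt0 addn_gt0 mult_j_gt0.
    by rewrite orbT andbT; lia.
  (* Here m_i is unchanged, but m_(i+1) has grown and e_(i+1) is straight: the run from v_c through
     v_i reaches v_(i+1), so m_(c-1) has the larger m_(i+1) as a summand. *)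
  have eq_p1 : p.-1 = i.+1 by lia.
  rewrite eq_p1 in str mult_p_lt mult_p1.
  have i_gt0 : 0 < i by case: (posnP i) str => // ->; rewrite (negbTE curved1).
  have [c hc [sc rc]] := run_start_exists d_enriques i_gt0.
  have [l hl] := proximity_range_exists d_enriques (i := c.-1) ltac:(lia).
  have lt_il : i < l.
    have [hcl _ _ _ stop] := hl; rewrite ltnNge; apply/negP => le_li.
    rewrite (_ : c.-1.+1 = c) in stop; last lia.
    have str_l : straight d l.+1.
      have [->//|ne_li] := eqVneq l i; by have [] := rc l.+1 ltac:(lia).
    move: (stop sc); rewrite str_l => /andP[lt_cl].
    by have [_ /negbTE->] := rc l ltac:(lia).
  apply: (mult_ltn_below d_enriques d'_enriques (k := c.-1)) => //; first lia.
    by move=> k r lt_kc; apply: grow; lia.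
  rewrite (mult_proximity_range d_enriques hl).
  have hl' : proximity_range d' c.-1 l by apply: same => //; lia.
  rewrite (mult_proximity_range d'_enriques hl').
  have [_ /andP[_ lt_ln]] : True /\ c.-1 < l < n by case: hl.
  apply: (@ltn_sum_nat_widen _ _ _ _ _ i.+1) => //; try lia.
  by move=> k hk; apply: le_m; lia.
(* A curved e_(p-1) makes v_(p-1) a run start, hence the first vertex of the run. Then m_i is
   unchanged, and no range from below [i] can cross the curved e_(i+1). *)
- have eq_p1 : p.-1 = i.+1.
    have [//|ne_p1] := eqVneq p.-1 i.+1; have := nst_d p.-1 ltac:(lia).
    by rewrite /run_start negb_or (negbTE curved).
  apply/eqP/esym.
  apply: (mult_eq_below d_enriques d'_enriques lt_in) => // [k l lt_ki hkl|];
    last first.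
    by rewrite mult_diff (_ : p - i.+2 = 0) ?addn0 //; lia.
  split; last by apply: same => //; lia.
  have [hkl' _ sk _ _] := hkl; rewrite leqNgt; apply/negP => lt_il.
  by move: curved; rewrite eq_p1 sk //; lia.
Qed.

Theorem theorem4p2 (n : nat) (n_ge3 : 3 <= n) (d d' : decoration n)
    (p : nat) (d_enriques : enriques_diagram d)
    (d'_enriques : enriques_diagram d')
    (d_op_d' : straightening p d = Some d' \/ breaking_op p d = Some d') :
  [/\ (forall j, j < n -> mult d j <= mult d' j) /\
        (exists2 j, j < n & mult d j < mult d' j),
      mult d 0 <= mult d' 0 /\
        (mult d' 0 = mult d 0 <->
           breaking_op p d = Some d' /\ ~~ straight d p.-1) &
      milnor d < milnor d'].
Proof.
have n_gt0 : 0 < n by lia.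
suff [le_m [ex_lt m0_eq]] : (forall j, j < n -> mult d j <= mult d' j) /\
    (exists2 j, j < n & mult d j < mult d' j) /\
    (mult d' 0 = mult d 0 <->
       breaking_op p d = Some d' /\ ~~ straight d p.-1).
  by split=> //; [split=> //; apply: le_m | apply: milnor_ltn].
case: d_op_d' => op.
  have [le_m lt_m0] := mult_straightening d_enriques d'_enriques op.
  split=> //; split; first by exists 0.
  split=> [eq_m0|[+ _]]; first by rewrite eq_m0 ltnn in lt_m0.
  (* The two operators are never both defined at [p]: one needs e_p curved, the other straight. *)
  move: op; rewrite /straightening /breaking_op.
  case: ifP => // /and3P[p2 pn /negP curved] _; case: ifP => //.
  case/and3P=> _ _ /straight_pathP[_ _ str _] _.
  by case: curved; apply: str; lia.
have [le_m ex_lt m0_eq] := mult_breaking_op d_enriques d'_enriques op.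
split=> //; split=> //; split=> [eq_m0|[_ curved]].
  by rewrite -m0_eq eq_m0.
by apply/eqP; rewrite m0_eq.
Qed.
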